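(* For every integer $t\ge 2$ there is a digraph $D$ which does not contain the complete digraph $\overset{\longleftrightarrow}{K_t}$ as a strong minor and whose dichromatic number is at least $\left\lceil\frac{3}{2}(t-1)\right\rceil$.
   Context: Digraphs are finite and loopless, without parallel arcs; a pair of opposite arcs $(u,v),(v,u)$ is allowed and forms a directed cycle of length $2$. $\overset{\longleftrightarrow}{K_t}$ is the complete digraph of order $t$, containing all $t(t-1)$ possible arcs. For digraphs $D$ and $F$, $D$ contains $F$ as a strong minor if there exist pairwise disjoint non-empty subsets $(B_f)_{f\in V(F)}$ of $V(D)$ such that $B_f$ induces a strongly connected subdigraph of $D$ for every $f\in V(F)$ and for every arc $(f_1,f_2)$ of $F$ there is an arc of $D$ from $B_{f_1}$ to $B_{f_2}$. The dichromatic number $\vec{\chi}(D)$ is the smallest number of colors that can be used to color the vertices of $D$ such that every color class induces an acyclic subdigraph of $D$ (i.e. one without directed cycles). *)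

(* Defs.v *)
From mathcomp Require Import all_boot all_order all_algebra.

Set Implicit Arguments.
Unset Strict Implicit.
Unset Printing Implicit Defensive.

Record digraph := Digraph {
  vertex :> finType;
  arc : rel vertex;
  arc_irr : irreflexive arc }.

Lemma neq_irr (T : eqType) : irreflexive (fun u v : T => u != v).
Proof. by move=> x; rewrite eqxx. Qed.

Definition complete_digraph (t : nat) : digraph := Digraph (@neq_irr 'I_t).

Lemma induced_irr (D : digraph) (A : {set D}) :
  irreflexive (fun u v : {x : D | x \in A} => arc (val u) (val v)).
Proof. by move=> x; rewrite arc_irr. Qed.

Definition induced (D : digraph) (A : {set D}) : digraph :=
  Digraph (@induced_irr D A).

Definition strongly_connected (D : digraph) : Prop :=
  forall x y : D, connect (@arc D) x y.

Definition strong_minor (D F : digraph) : Prop :=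
  exists B : F -> {set D},
    [/\ forall f, B f != set0,
        forall f g, f != g -> [disjoint B f & B g],
        forall f, strongly_connected (induced (B f))
      & forall f g, arc f g ->
          exists x y, [/\ x \in B f, y \in B g & arc x y]].

(* A directed cycle is a nonempty duplicate-free sequence of vertices, so its
   length is of the form k.+1 with k < #|D|: this bound only serves to make the
   predicate boolean, and is removed by acyclicP. *)
Definition acyclic (D : digraph) : bool :=
  [forall k : 'I_#|D|, forall c : k.+1.-tuple D, ~~ ucycleb (@arc D) c].

Lemma acyclicP (D : digraph) :
  reflect (forall c : seq D, ucycle (@arc D) c -> c = [::]) (acyclic D).
Proof.
apply: (iffP forallP) => [acD [|x s] // /andP[cyc unq] | acD k].
  have lt_s : size s < #|D|.
    by rewrite -[(size s).+1]/(size (x :: s)) -(card_uniqP unq) max_card.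
  move/forallP/(_ (in_tuple (x :: s))): (acD (Ordinal lt_s)).
  by rewrite /ucycleb cyc unq.
apply/forallP => c; apply/negP => /acD c0.
by move: (size_tuple c); rewrite c0.
Qed.

Definition dicolorable (D : digraph) (k : nat) : bool :=
  [exists c : {ffun D -> 'I_k},
     [forall i, acyclic (induced [set x | c x == i])]].

Lemma dicolorable_ex (D : digraph) : exists k, dicolorable D k.
Proof.
exists #|D|; apply/existsP; exists [ffun x => enum_rank x].
apply/forallP => i; apply/acyclicP => -[|x s] // /andP[/= cyc _].
have eq_val (u v : induced [set x | [ffun x => enum_rank x] x == i]) : u = v.
  apply/val_inj/enum_rank_inj; move: (valP u) (valP v).
  by rewrite !inE !ffunE => /eqP-> /eqP->.
by move: cyc; rewrite rcons_path (eq_val (last x s) x) arc_irr andbF.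
Qed.

Definition dichromatic_number (D : digraph) : nat := ex_minn (dicolorable_ex D).

(* Main.v *)
From Pilot Require Import Defs.
From mathcomp Require Import all_boot all_order all_algebra.
From mathcomp Require Import lra.

(** Replace every vertex of the directed triangle by a complete digraph on
    [n = t - 1] vertices, with all arcs from each part to the next one.  The
    parts are cyclically ordered, so a walk can return to a part it has left
    only after visiting both others.

    A strongly connected vertex set therefore lies inside one part or meets all
    three ([strong_in_part_or_meets_all]).  Two sets inside different parts are not joined
    by arcs in both directions, hence the branch sets of a complete strong minor
    all meet a common part ([branch_sets_meet_common_part]); being disjoint,
    there are at most [n] of them.

    An acyclic set contains at most one vertex of each part, because of the
    2-cycles inside the parts, and misses a part, because of the directed
    triangles across them.  So a colour class has at most two of the [3 * n]
    vertices, and at least [3 * n / 2] colours are needed. *)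

Set Implicit Arguments.
Unset Strict Implicit.
Unset Printing Implicit Defensive.

(* Makes [arc] the arc relation of a digraph, not a segment of a cyclic
   sequence. *)
Import Pilot.Defs GRing.Theory Num.Theory.

Section InducedSubdigraphs.
Variables (D : digraph) (A : {set D}).

(** Follow a path inside [A] from [x] to any other vertex of [A]: since no arc of
    [A] leaves [S], the path never does. *)
Lemma strong_induced_sub (S : {set D}) (x : D) :
  strongly_connected (induced A) -> x \in A -> x \in S ->
  (forall u v, u \in A -> v \in A -> arc u v -> u \in S -> v \in S) ->
  A \subset S.
Proof.
move=> sA Ax Sx S_closed; apply/subsetP => y Ay.
have /connectP[s] := sA (Sub x Ax) (Sub y Ay).
elim: s x Ax Sx => [|[z Az] s IHs] x Ax Sx /=; first by move=> _ [->].
by case/andP=> arc_xz; apply: IHs; apply: S_closed arc_xz Sx.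
Qed.

(** Lets a cycle be exhibited by vertices of [D] itself, instead of elements of
    the subtype that carries [induced A]. *)
Lemma acyclic_induced_cycle (c : seq D) :
  acyclic (induced A) -> {subset c <= A} -> ucycle (@arc D) c -> c = [::].
Proof.
move=> /acyclicP acA /allP/= cA /andP[cyc_c uniq_c].
have [s def_c] : exists s : seq (induced A), c = map val s.
  elim: c cA {cyc_c uniq_c} => [|x c IHc] /=; first by exists [::].
  by case/andP=> Ax /IHc[s ->]; exists ((Sub x Ax : induced A) :: s).
rewrite def_c (acA s) // /ucycle.
move: cyc_c uniq_c; rewrite def_c cycle_map (map_inj_uniq val_inj) => cyc_s ->.
by rewrite andbT.
Qed.

End InducedSubdigraphs.

(** The colour classes of an optimal colouring are acyclic and cover [D]. *)
Lemma card_leq_dichromatic (D : digraph) (a : nat) :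
  (forall A : {set D}, acyclic (induced A) -> #|A| <= a) ->
  #|D| <= dichromatic_number D * a.
Proof.
move=> le_a; rewrite /dichromatic_number; case: ex_minnP => k.
case/existsP=> c /forallP ac_c _.
rewrite -sum1_card (partition_big c predT) //= -[k in k * a]card_ord -sum_nat_const.
apply: leq_sum => i _; rewrite sum1_card; apply: leq_trans (le_a _ (ac_c i)).
by apply/eq_leq/eq_card => x; rewrite !inE.
Qed.

(** The first component is the part, an element of [Z/3]; the second is the
    position of the vertex inside its part. *)
Definition triangle_blowup_arc n (u v : 'I_3 * 'I_n) :=
  (v.1 == u.1) && (v.2 != u.2) || (v.1 == u.1 + 1)%R.

Lemma succ3_neq (p : 'I_3) : (p == p + 1)%R = false.
Proof. by case: p => [[|[|[|]]]]. Qed.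

Lemma ord3_cases (p q : 'I_3) : [|| q == p, q == p + 1 | q == p + 1 + 1]%R.
Proof. by case: p q => [[|[|[|p]]] lt_p3] [[|[|[|q]]] lt_q3]. Qed.

Lemma triangle_blowup_irr n : irreflexive (@triangle_blowup_arc n).
Proof. by move=> u; rewrite /triangle_blowup_arc succ3_neq !eqxx. Qed.

Definition triangle_blowup n : digraph := Digraph (@triangle_blowup_irr n).

Section TriangleBlowup.
Variable n : nat.
Implicit Types (A B : {set triangle_blowup n}) (p : 'I_3).

Definition part p : {set triangle_blowup n} := [set u | u.1 == p].

(** Two vertices of one part form a directed 2-cycle. *)
Lemma acyclic_part_inj A :
  acyclic (induced A) -> {in A &, injective (fun u => u.1)}.
Proof.
move=> acA u v Au Av eq_uv; apply/eqP; apply/negPn/negP => neq_uv.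
have neq2 : u.2 != v.2.
  by move: neq_uv; rewrite -pair_eqE /pair_eq eq_uv eqxx.
suff: [:: u; v] = [::] by [].
apply: acyclic_induced_cycle acA _ _.
  by move=> w; rewrite !inE => /orP[] /eqP->.
by rewrite /ucycle /= /triangle_blowup_arc inE neq_uv eq_uv !eqxx (eq_sym v.2) neq2.
Qed.

(** One vertex from each part would give a directed triangle. *)
Lemma acyclic_misses_part A :
  acyclic (induced A) -> exists p, [disjoint A & part p].
Proof.
move=> acA; apply/existsP; apply: contraT; rewrite negb_exists => /forallP meets.
have pick_in p : exists2 u, u \in A & u.1 = p.
  have /pred0Pn[u /andP[/= Au]] := meets p.
  by rewrite inE => /eqP; exists u.
have [u Au u0] := pick_in 0%R; have [v Av v1] := pick_in 1%R.
have [w Aw w2] := pick_in (1 + 1)%R.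
suff: [:: u; v; w] = [::] by [].
apply: acyclic_induced_cycle acA _ _.
  by move=> x; rewrite !inE => /or3P[] /eqP->.
have neq1 (x y : triangle_blowup n) : x.1 != y.1 -> x != y.
  by apply: contraNneq => ->.
by rewrite /ucycle /= /triangle_blowup_arc !inE !negb_or !neq1 ?u0 ?v1 ?w2.
Qed.

Lemma card_acyclic A : acyclic (induced A) -> #|A| <= 2.
Proof.
move=> acA; rewrite -(card_in_imset (acyclic_part_inj acA)).
have [p /disjointFr A_p] := acyclic_misses_part acA.
have card_other : #|[set~ p]| = 2 by rewrite cardsC1 card_ord.
rewrite -[leqRHS]card_other; apply/subset_leq_card/subsetP => _ /imsetP[u Au ->].
rewrite !inE.
by have := A_p _ Au; rewrite inE => ->.
Qed.

(** The arcs leaving part [p] all go to part [p + 1], so if [B] avoids the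
    latter, no arc of [B] leaves part [p], and [B] is confined to it. *)
Lemma strong_meets_next B p :
  strongly_connected (induced B) -> ~~ [disjoint B & part p] ->
  ~~ (B \subset part p) -> ~~ [disjoint B & part (p + 1)%R].
Proof.
move=> sB /pred0Pn[x /andP[/= Bx px]]; apply: contra => /disjointFr B_p1.
apply: strong_induced_sub sB Bx px _ => u v _ Bv /= arc_uv.
have := B_p1 _ Bv; rewrite !inE => v_p1 /eqP up; move: arc_uv.
by rewrite /triangle_blowup_arc up v_p1 orbF => /andP[].
Qed.

(** Outside the first case [strong_meets_next] applies to every part that [B]
    meets; going around the triangle reaches all parts. *)
Lemma strong_in_part_or_meets_all B :
  B != set0 -> strongly_connected (induced B) ->
  (exists p, B \subset part p) \/ (forall p, ~~ [disjoint B & part p]).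
Proof.
move=> /set0Pn[x Bx] sB.
have [/existsP | ] := boolP [exists p, B \subset part p]; first by left.
rewrite negb_exists => /forallP B_sub; right.
have next p (meet : ~~ [disjoint B & part p]) := strong_meets_next sB meet (B_sub p).
have meet0 : ~~ [disjoint B & part x.1].
  by apply/pred0Pn; exists x; rewrite /= Bx inE eqxx.
move=> p; case/or3P: (ord3_cases x.1 p) => /eqP->; first exact: meet0.
  exact: next.
exact/next/next.
Qed.

(** If some branch set lies inside a part, that part works: a branch set avoiding
    it would lie inside another part, and two different parts are joined by arcs
    in only one direction.  Otherwise every branch set meets every part. *)
Lemma branch_sets_meet_common_part t (B : 'I_t -> {set triangle_blowup n}) :
  (forall f, B f != set0) ->
  (forall f, strongly_connected (induced (B f))) ->
  (forall f g, f != g -> exists x y, [/\ x \in B f, y \in B g & arc x y]) ->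
  exists p, forall f, ~~ [disjoint B f & part p].
Proof.
move=> B0 sB arcB.
have [/existsP[f0 /existsP[p B_p]] | no_sub] :=
  boolP [exists f, [exists p, B f \subset part p]]; last first.
  exists 0%R => f; case: (strong_in_part_or_meets_all (B0 f) (sB f)) => // -[p B_p].
  by case/existsP: no_sub; exists f; apply/existsP; exists p.
exists p => f; have [-> | neq_f] := eqVneq f f0.
  have [x Bx] := set0Pn _ (B0 f0).
  by apply/pred0Pn; exists x; rewrite /= Bx (subsetP B_p).
case: (strong_in_part_or_meets_all (B0 f) (sB f)) => [[q B_q] | //].
have [x [y [/(subsetP B_q) + /(subsetP B_p) +]]] := arcB f f0 neq_f.
rewrite eq_sym in neq_f.
have [u [v [/(subsetP B_p) + Bv]]] := arcB f0 f neq_f.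
have /(subsetP B_q) := Bv; rewrite !inE /= /triangle_blowup_arc.
move=> /eqP v_q /eqP-> + /eqP-> /eqP->; rewrite v_q => arc_pq arc_qp.
(* [p = q + 1] and [q = p + 1] are incompatible in [Z/3]. *)
have eq_qp : q = p.
  move: arc_pq arc_qp; case: (eqVneq q p) => //= _.
  by case: p q {B_p B_q v_q} => [[|[|[|p]]] lt_p3] [[|[|[|q]]] lt_q3].
by apply/pred0Pn; exists v; rewrite /= Bv inE v_q eq_qp eqxx.
Qed.

(** Choosing in each branch set a vertex of the common part injects the [t]
    branch sets into the [n] vertices of that part. *)
Lemma triangle_blowup_minor_free t :
  n < t -> ~ strong_minor (triangle_blowup n) (complete_digraph t).
Proof.
move=> lt_nt [B [B0 disjB sB arcB]].
have [p meet_p] := branch_sets_meet_common_part B0 sB arcB.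
have in_part f : exists i, (p, i) \in B f.
  have /pred0Pn[[q i] /andP[/= Bqi]] := meet_p f.
  by rewrite inE /= => /eqP eq_qp; exists i; rewrite -eq_qp.
pose h f := xchoose (in_part f).
have h_inj : injective h.
  move=> f g eq_h; apply/eqP; apply: contraT => /disjB/disjointFr.
  by move/(_ _ (xchooseP (in_part f))); rewrite -/(h f) eq_h (xchooseP (in_part g)).
by have := leq_card h h_inj; rewrite !card_ord leqNgt lt_nt.
Qed.

Lemma triangle_blowup_dichromatic :
  3 * n <= dichromatic_number (triangle_blowup n) * 2.
Proof.
have := card_leq_dichromatic card_acyclic.
by rewrite card_prod !card_ord.
Qed.

End TriangleBlowup.

Theorem proposition2 (t : nat) (ht : 2 <= t) :
  exists D : digraph,
    ~ strong_minor D (complete_digraph t) /\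
    (Num.ceil (3 / 2 * (t%:R - 1) : rat) <= (dichromatic_number D)%:Z)%R.
Proof.
case: t ht => // n _; exists (triangle_blowup n); split.
  exact: triangle_blowup_minor_free.
have := triangle_blowup_dichromatic n; move: (dichromatic_number _) => k le_nk.
rewrite ceil_le_int -[n.+1%:R%R]natr1 addrK.
have : ((3 * n)%:R <= (k * 2)%:R :> rat)%R by rewrite ler_nat.
rewrite !natrM -pmulrn; lra.
Qed.
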